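(* Consider the problem $\min_{x\in\mathbb{R}^{d_x}}\max_{y\in\mathbb{R}^{d_y}} r(x)+F(x,y)-g(y)$ under the assumptions stated in the context, and the Accelerated Proximal Point Algorithm described in the context with $\alpha\in(0,1]$, $\theta_y>0$ and $$\eta_z=\frac{\mu_x}{2},\qquad \eta_y=\min\left\{\frac{1}{2\mu_y},\frac{\theta_y}{2\alpha}\right\}.$$ Then, to find an $\epsilon$-accurate solution of the problem, this algorithm requires the following number of iterations: $$K=\mathcal{O}\left(\max\left\{\frac1\alpha,\frac{\alpha}{\theta_y\mu_y}\right\}\log\frac1\epsilon\right).$$ In this case the $\epsilon$-accurate solution is given by $(-\mu_x^{-1}z^K,y^K)$, where $(z^K,y^K)$ is the output of the algorithm.
   Context: Setting. $\mu_x,\mu_y,L>0$. $F:\mathbb{R}^{d_x}\times\mathbb{R}^{d_y}\to\mathbb{R}$ is continuously differentiable; $F(\cdot,y)$ is $\mu_x$-strongly convex for every $y$; $F(x,\cdot)$ is $\mu_y$-strongly concave for every $x$; and $F$ is $L$-smooth: $\|\nabla F(x_1,y_1)-\nabla F(x_2,y_2)\|^2\le L^2(\|x_1-x_2\|^2+\|y_1-y_2\|^2)$ for all $x_1,x_2,y_1,y_2$. The functions $r:\mathbb{R}^{d_x}\to\mathbb{R}\cup\{+\infty\}$ and $g:\mathbb{R}^{d_y}\to\mathbb{R}\cup\{+\infty\}$ are proper, lower semicontinuous and convex. The problem has a unique solution $(x^*,y^* )$, characterized by $-\nabla_xF(x^*,y^* )\in\partial r(x^* )$ and $\nabla_yF(x^*,y^*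 )\in\partial g(y^* )$. A pair $(x,y)$ is an $\epsilon$-accurate solution if $\|x-x^*\|^2+\|y-y^*\|^2\le\epsilon$. Put $\hat F(x,y)=F(x,y)-\frac{\mu_x}{2}\|x\|^2+\frac{\mu_y}{2}\|y\|^2$. Accelerated Proximal Point Algorithm. Input: $z^0=z_f^0\in\mathbb{R}^{d_x}$, $y^0=y_f^0\in\mathbb{R}^{d_y}$. Parameters: $\alpha\in(0,1]$, $\eta_z,\eta_y,\theta_y>0$, $K\in\{1,2,\ldots\}$. For $k=0,\ldots,K-1$: 1. $(z_g^k,y_g^k)=\alpha(z^k,y^k)+(1-\alpha)(z_f^k,y_f^k)$. 2. Find (any) $(x_f^{k+1},y_f^{k+1},z_f^{k+1},w_f^{k+1})\in\mathbb{R}^{d_x}\times\mathbb{R}^{d_y}\times\mathbb{R}^{d_x}\times\mathbb{R}^{d_y}$ such that $z_f^{k+1}-\nabla_x\hat F(x_f^{k+1},y_f^{k+1})\in\partial r(x_f^{k+1})$, $w_f^{k+1}+\nabla_y\hat F(x_f^{k+1},y_f^{k+1})\in\partial g(y_f^{k+1})$, and $\frac{8}{\mu_x}\|\Delta_x^k\|^2+\theta_y\|\Delta_y^k\|^2\le\frac{\mu_x}{8}\|x_f^{k+1}+\mu_x^{-1}z_g^k\|^2+\theta_y^{-1}\|y_f^{k+1}-y_g^k\|^2$, where $\Delta_x^k=z_f^{k+1}+\frac{\mu_x}{2}(x_f^{k+1}-\mu_x^{-1}z_g^k)$ and $\Delta_y^k=w_f^{k+1}+\mu_yy_f^{k+1}+\theta_y^{-1}(y_f^{k+1}-y_g^k)$.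 3. $z^{k+1}=z^k+\eta_z\mu_x^{-1}(z_f^{k+1}-z^k)-\eta_z(x_f^{k+1}+\mu_x^{-1}z_f^{k+1})$. 4. $y^{k+1}=y^k+\eta_y\mu_y(y_f^{k+1}-y^k)-\eta_y(w_f^{k+1}+\mu_yy_f^{k+1})$. Output: $(z^K,y^K)$. Complexity convention. ''Requires $K=\mathcal{O}(Q\log\frac1\epsilon)$ iterations'' means: there are a universal constant $c>0$ and a constant $C\geq 2$, possibly depending on the problem, the parameters and the initial point but not on $\epsilon$, such that for every $\epsilon\in(0,1)$ and every integer $K\ge cQ\log\frac{C}{\epsilon}$ the pair $(-\mu_x^{-1}z^K,y^K)$ is an $\epsilon$-accurate solution. *)

(* Defs.v *)
From HB Require Import structures.
From mathcomp Require Import all_boot all_order all_algebra.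
From mathcomp Require Import all_classical all_reals all_analysis.

Set Implicit Arguments.
Unset Strict Implicit.
Unset Printing Implicit Defensive.

Import Order.TTheory GRing.Theory Num.Theory.
Import numFieldNormedType.Exports.

Local Open Scope classical_set_scope.
Local Open Scope ring_scope.

Definition dot (R : realType) (n : nat) (u v : 'rV[R]_n) : R :=
  \sum_(i < n) u 0 i * v 0 i.

(* The squared Euclidean norm; the library norm `|u| on 'rV[R]_n is the
   sup norm and is used here only through the topology it induces. *)
Definition sqnorm (R : realType) (n : nat) (u : 'rV[R]_n) : R := dot u u.

Definition gradient (R : realType) (n : nat) (f : 'rV[R]_n -> R)
    (x : 'rV[R]_n) : 'rV[R]_n :=
  \row_(i < n) 'D_(delta_mx 0 i) f x.

Definition grad_x (R : realType) (dx dy : nat)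
    (F : 'rV[R]_dx -> 'rV[R]_dy -> R) (x : 'rV[R]_dx) (y : 'rV[R]_dy) :
    'rV[R]_dx :=
  gradient (fun x' => F x' y) x.

Definition grad_y (R : realType) (dx dy : nat)
    (F : 'rV[R]_dx -> 'rV[R]_dy -> R) (x : 'rV[R]_dx) (y : 'rV[R]_dy) :
    'rV[R]_dy :=
  gradient (F x) y.

Definition continuously_differentiable (R : realType) (dx dy : nat)
    (F : 'rV[R]_dx -> 'rV[R]_dy -> R) : Prop :=
  [/\ forall p : 'rV[R]_dx * 'rV[R]_dy,
        differentiable (fun q : 'rV[R]_dx * 'rV[R]_dy => F q.1 q.2) p,
      continuous (fun q : 'rV[R]_dx * 'rV[R]_dy => grad_x F q.1 q.2)
    & continuous (fun q : 'rV[R]_dx * 'rV[R]_dy => grad_y F q.1 q.2)].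

Definition strongly_convex (R : realType) (n : nat) (mu : R)
    (f : 'rV[R]_n -> R) : Prop :=
  forall (u v : 'rV[R]_n) (t : R), 0 <= t <= 1 ->
    f (t *: u + (1 - t) *: v) <=
      t * f u + (1 - t) * f v - mu / 2 * (t * (1 - t)) * sqnorm (u - v).

Definition strongly_concave (R : realType) (n : nat) (mu : R)
    (f : 'rV[R]_n -> R) : Prop :=
  strongly_convex mu (fun u => - f u).

Definition smooth (R : realType) (dx dy : nat) (L : R)
    (F : 'rV[R]_dx -> 'rV[R]_dy -> R) : Prop :=
  forall (x1 x2 : 'rV[R]_dx) (y1 y2 : 'rV[R]_dy),
    sqnorm (grad_x F x1 y1 - grad_x F x2 y2) +
    sqnorm (grad_y F x1 y1 - grad_y F x2 y2) <=
      L ^+ 2 * (sqnorm (x1 - x2) + sqnorm (y1 - y2)).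

(* Functions to R \cup {+oo} are functions to \bar R that avoid -oo. *)
Definition proper_fun (R : realType) (n : nat) (f : 'rV[R]_n -> \bar R) :
    Prop :=
  (forall u, f u != -oo%E) /\ (exists u, (f u < +oo)%E).

Definition convex_efun (R : realType) (n : nat) (f : 'rV[R]_n -> \bar R) :
    Prop :=
  forall (u v : 'rV[R]_n) (t : R), 0 < t < 1 ->
    (f (t *: u + (1 - t) *: v)%R <= t%:E * f u + (1 - t)%R%:E * f v)%E.

Definition proper_lsc_convex (R : realType) (n : nat)
    (f : 'rV[R]_n -> \bar R) : Prop :=
  [/\ proper_fun f, lower_semicontinuous f & convex_efun f].

(* For proper f this set is empty whenever f u = +oo. *)
Definition subdifferential (R : realType) (n : nat) (f : 'rV[R]_n -> \bar R)
    (u : 'rV[R]_n) : set 'rV[R]_n :=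
  [set s | forall v : 'rV[R]_n, (f u + (dot s (v - u)%R)%:E <= f v)%E].

(* Since +oo - +oo = -oo in \bar R, the value is -oo as soon as g y = +oo:
   the inner maximum ranges over the domain of g, whatever r x is. *)
Definition objective (R : realType) (dx dy : nat)
    (F : 'rV[R]_dx -> 'rV[R]_dy -> R)
    (r : 'rV[R]_dx -> \bar R) (g : 'rV[R]_dy -> \bar R)
    (x : 'rV[R]_dx) (y : 'rV[R]_dy) : \bar R :=
  (r x + (F x y)%:E - g y)%E.

Definition max_objective (R : realType) (dx dy : nat)
    (F : 'rV[R]_dx -> 'rV[R]_dy -> R)
    (r : 'rV[R]_dx -> \bar R) (g : 'rV[R]_dy -> \bar R)
    (x : 'rV[R]_dx) : \bar R :=
  ereal_sup (range (objective F r g x)).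

Definition minimax_solution (R : realType) (dx dy : nat)
    (F : 'rV[R]_dx -> 'rV[R]_dy -> R)
    (r : 'rV[R]_dx -> \bar R) (g : 'rV[R]_dy -> \bar R)
    (xs : 'rV[R]_dx) (ys : 'rV[R]_dy) : Prop :=
  [/\ objective F r g xs ys \is a fin_num,
      objective F r g xs ys = max_objective F r g xs
    & forall x, (max_objective F r g xs <= max_objective F r g x)%E].

Definition accurate_solution (R : realType) (dx dy : nat) (eps : R)
    (xs : 'rV[R]_dx) (ys : 'rV[R]_dy) (x : 'rV[R]_dx) (y : 'rV[R]_dy) :
    Prop :=
  sqnorm (x - xs) + sqnorm (y - ys) <= eps.

Definition hatF (R : realType) (dx dy : nat) (mux muy : R)
    (F : 'rV[R]_dx -> 'rV[R]_dy -> R) (x : 'rV[R]_dx) (y : 'rV[R]_dy) : R :=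
  F x y - mux / 2 * sqnorm x + muy / 2 * sqnorm y.

Record app_state (R : realType) (dx dy : nat) := AppState {
  st_z : 'rV[R]_dx;
  st_y : 'rV[R]_dy;
  st_zf : 'rV[R]_dx;
  st_yf : 'rV[R]_dy }.

(* A relation, not a function: any inexact proximal point is allowed. *)
Definition app_step (R : realType) (dx dy : nat) (mux muy : R)
    (F : 'rV[R]_dx -> 'rV[R]_dy -> R)
    (r : 'rV[R]_dx -> \bar R) (g : 'rV[R]_dy -> \bar R)
    (alpha etaz etay thetay : R) (s s' : app_state R dx dy) : Prop :=
  let zg := alpha *: st_z s + (1 - alpha) *: st_zf s in
  let yg := alpha *: st_y s + (1 - alpha) *: st_yf s in
  exists (xf : 'rV[R]_dx) (yf : 'rV[R]_dy) (zf : 'rV[R]_dx) (wf : 'rV[R]_dy),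
    let Deltax := zf + (mux / 2) *: (xf - mux^-1 *: zg) in
    let Deltay := wf + muy *: yf + thetay^-1 *: (yf - yg) in
    [/\ subdifferential r xf (zf - grad_x (hatF mux muy F) xf yf),
        subdifferential g yf (wf + grad_y (hatF mux muy F) xf yf),
        8 / mux * sqnorm Deltax + thetay * sqnorm Deltay <=
          mux / 8 * sqnorm (xf + mux^-1 *: zg)
          + thetay^-1 * sqnorm (yf - yg)
      & s' = {| st_z := st_z s + (etaz * mux^-1) *: (zf - st_z s)
                          - etaz *: (xf + mux^-1 *: zf);
                st_y := st_y s + (etay * muy) *: (yf - st_y s)
                          - etay *: (wf + muy *: yf);
                st_zf := zf;
                st_yf := yf |}].

(* (zK, yK) is a possible output of the K-iteration run started at (z0, y0). *)
Definition app_output (R : realType) (dx dy : nat) (mux muy : R)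
    (F : 'rV[R]_dx -> 'rV[R]_dy -> R)
    (r : 'rV[R]_dx -> \bar R) (g : 'rV[R]_dy -> \bar R)
    (alpha etaz etay thetay : R) (z0 : 'rV[R]_dx) (y0 : 'rV[R]_dy)
    (K : nat) (zK : 'rV[R]_dx) (yK : 'rV[R]_dy) : Prop :=
  exists s : nat -> app_state R dx dy,
    [/\ s 0%N = {| st_z := z0; st_y := y0; st_zf := z0; st_yf := y0 |},
        forall k : nat, (k < K)%N ->
          app_step mux muy F r g alpha etaz etay thetay (s k) (s k.+1),
        zK = st_z (s K)
      & yK = st_y (s K)].

(* Main.v *)
Require Import Defs.
From HB Require Import structures.
From mathcomp Require Import all_boot all_order all_algebra.
From mathcomp Require Import all_classical all_reals all_analysis.
From mathcomp Require Import ring lra.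

(** The minimax problem is turned into a strongly convex minimisation in (z, y).
Write F = hatF + mux/2 |x|^2 - muy/2 |y|^2, with hatF convex-concave, and
dualise the quadratic: mux/2 |x|^2 = max_z (- <x, z> - |z|^2 / (2 mux)).  The
problem becomes the minimisation of

  P (z, y) = |z|^2 / (2 mux) + muy/2 |y|^2 + G (z, y),
  G (z, y) = sup_x (<x, z> - r x - hatF x y) + g y,

where G is jointly convex, and the minimiser is zs = - mux xs, ys.  The two
inclusions of an iteration say exactly that (xf, wf) is a subgradient of G at
(zf, yf), so an iteration is an inexact proximal step on P followed by an
extrapolation: an accelerated proximal point method, with linear rate because
P is strongly convex.

G is never defined as a supremum.  It is only needed at points that carry such
a certificate (x, w), where x attains the supremum (dual_point, dual_value);
the strong subgradient inequality of P between two certified points is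
dual_value_convex.  That (zs, ys) is certified, with zero subgradient of P, is
the first order optimality of the minimax solution.  In y it is immediate; in
x it is an envelope argument, which strong concavity and smoothness make
quantitative: moving xs by t d increases max_y (F - g) by at most
t <grad_x F, d> + O(t^2) (subdifferential_opp_grad_x).

Let d be the subgradient of P at the new point f, let p be the previous one,
and let q = alpha u + (1 - alpha) p be the extrapolated one, where u = (z, y).
Strong convexity of P compares f with the solution, convexity compares it with
p; the error criterion bounds <d, f - q> (inexact_prox_x, inexact_prox_y); and
the update of u costs at most a multiple of |d|^2 (block_descent).  Together,
the energy alpha (2/mux |z - zs|^2 + |y - ys|^2 / etay) + 2 (P f - P (zs, ys))
contracts by 1 - rho when rho is at most 1/2, alpha and etay muy
(lyapunov_contracts); rho = 1 / (2 max (1/alpha, alpha / (thetay muy))) is.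

The initial point need not lie in the domain of P, so the recursion starts
after one iteration, whose result is bounded in terms of the initial point
alone (lyapunov_first_step). *)

Set Implicit Arguments.
Unset Strict Implicit.
Unset Printing Implicit Defensive.

Import Order.TTheory GRing.Theory Num.Theory.
Import numFieldNormedType.Exports.

Local Open Scope classical_set_scope.
Local Open Scope ring_scope.

(** * Euclidean geometry of row vectors *)

Section DotProduct.
Variables (R : realType) (n : nat).
Implicit Types (u v w : 'rV[R]_n) (a : R).

Lemma dotC u v : dot u v = dot v u.
Proof. by apply: eq_bigr => i _; rewrite mulrC. Qed.

Lemma dotDl u v w : dot (u + v) w = dot u w + dot v w.
Proof. by rewrite -big_split; apply: eq_bigr => i _; rewrite mxE mulrDl. Qed.

Lemma dotZl a u v : dot (a *: u) v = a * dot u v.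
Proof. by rewrite mulr_sumr; apply: eq_bigr => i _; rewrite mxE mulrA. Qed.

Lemma dotNl u v : dot (- u) v = - dot u v.
Proof. by rewrite -scaleN1r dotZl mulN1r. Qed.

Lemma dotDr u v w : dot w (u + v) = dot w u + dot w v.
Proof. by rewrite dotC dotDl !(dotC w). Qed.

Lemma dotZr a u v : dot u (a *: v) = a * dot u v.
Proof. by rewrite dotC dotZl (dotC u). Qed.

Lemma dotNr u v : dot u (- v) = - dot u v.
Proof. by rewrite dotC dotNl (dotC u). Qed.

Lemma sqnorm_ge0 u : 0 <= sqnorm u.
Proof. by apply: sumr_ge0 => i _; rewrite -expr2 sqr_ge0. Qed.

Definition dotE := (dotDl, dotDr, dotNl, dotNr, dotZl, dotZr).

Lemma sqnormN u : sqnorm (- u) = sqnorm u.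
Proof. by rewrite /sqnorm !dotE opprK. Qed.

Lemma sqnormBC u v : sqnorm (u - v) = sqnorm (v - u).
Proof. by rewrite -opprB sqnormN. Qed.

Lemma sqnormZ a u : sqnorm (a *: u) = a ^+ 2 * sqnorm u.
Proof. by rewrite /sqnorm !dotE; ring. Qed.

Lemma sqnorm_expand u v :
  sqnorm v = sqnorm u + 2 * dot u (v - u) + sqnorm (v - u).
Proof. by rewrite /sqnorm !dotE (dotC v u); ring. Qed.

Lemma dot0l u : dot 0 u = 0.
Proof. by rewrite -(scale0r (0 : 'rV[R]_n)) dotZl mul0r. Qed.

Lemma dot_delta (i : 'I_n) u : dot (delta_mx 0 i) u = u 0 i.
Proof.
rewrite /dot (bigD1 i)//= big1 ?addr0 => [|j ji]; rewrite mxE eqxx /=.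
  by rewrite eqxx mul1r.
by rewrite (negPf ji) mul0r.
Qed.

Lemma segment_subr u v a : a *: u + (1 - a) *: v - v = a *: (u - v).
Proof.
by rewrite scalerBl scale1r scalerBr -addrA [X in _ + X]addrAC subrr add0r.
Qed.

Lemma dot_young a u v : 0 < a ->
  2 * dot u v <= a * sqnorm u + a^-1 * sqnorm v.
Proof.
move=> a0.
have E : a * sqnorm (u - a^-1 *: v) =
    a * sqnorm u + a^-1 * sqnorm v - 2 * dot u v.
  by rewrite /sqnorm !dotE (dotC v u); field; exact: lt0r_neq0.
by rewrite -subr_ge0 -E mulr_ge0 ?sqnorm_ge0 ?ltW.
Qed.
End DotProduct.

(** * Gradients and strong convexity *)

Section Gradient.
Variables (R : realType) (n : nat).
Implicit Types (f : 'rV[R]_n -> R) (u v : 'rV[R]_n) (mu : R).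

Lemma derive_gradient f u v :
  differentiable f u -> 'D_v f u = dot (gradient f u) v.
Proof.
move=> df; rewrite deriveE// {1}(row_sum_delta v) linear_sum.
by apply: eq_bigr => i _; rewrite linearZ /= mxE deriveE// mulrC.
Qed.

(** Divide the strong convexity inequality on the segment from u to v by the
step h and let h decrease to 0. *)
Lemma strongly_convex_gradient f mu u v :
  differentiable f u -> strongly_convex mu f ->
  f u + dot (gradient f u) (v - u) + mu / 2 * sqnorm (v - u) <= f v.
Proof.
move=> df cf; rewrite -derive_gradient//.
pose slope := fun h : R => h^-1 *: (f (h *: (v - u) + u) - f u).
have cvgl : slope h @[h --> 0^'+] --> 'D_(v - u) f u.
  by apply: cvg_dnbhs_at_right; apply: (diff_derivable (v := v - u)).
pose q := mu / 2 * sqnorm (v - u).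
have cvgr : f v - f u - q + h * q @[h --> (0:R)^'+] --> f v - f u - q + 0 * q.
  apply: cvg_at_right_filter.
  apply: cvgD; first exact: cvg_cst.
  apply: cvgM; [exact: cvg_id|exact: cvg_cst].
suff : 'D_(v - u) f u <= f v - f u - q + 0 * q by rewrite /q mul0r addr0; lra.
apply: ler_cvg_to cvgl cvgr _.
near=> h; have h0 : 0 < h by [].
have h1 : h <= 1 by near: h; exact: nbhs_right_le.
rewrite /slope -[_ *: _]/(_ * _) mulrC ler_pdivrMr//.
have := cf v u h; rewrite h1 ltW// => /(_ isT).
rewrite (_ : h *: v + (1 - h) *: u = h *: (v - u) + u); last first.
  by rewrite scalerBl scale1r scalerBr addrA addrAC.
rewrite /q; lra.
Unshelve. all: by end_near.
Qed.

Lemma derive_sqnorm u v : is_derive u v (@sqnorm R n) (2 * dot u v).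
Proof.
have quot h : h != 0 ->
    h^-1 *: (sqnorm (h *: v + u) - sqnorm u) = 2 * dot u v + h * sqnorm v.
  move=> h0; rewrite /sqnorm !dotE (dotC v u) -[_ *: _]/(_ * _).
  by field; exact: h0.
have cv :
    h^-1 *: (sqnorm (h *: v + u) - sqnorm u) @[h --> (0:R)^'] --> 2 * dot u v.
  rewrite -[X in _ --> X]addr0 -[X in _ --> _ + X](mul0r (sqnorm v)).
  apply: cvg_trans (near_eq_cvg (f := fun h => 2 * dot u v + h * sqnorm v) _) _.
    by near=> h; rewrite quot//; near: h; exact: nbhs_dnbhs_neq.
  apply: cvg_within_filter.
  apply: cvgD; first exact: cvg_cst.
  apply: cvgM; [exact: cvg_id|exact: cvg_cst].
apply: DeriveDef; first by apply/cvg_ex; exists (2 * dot u v).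
exact: cvg_lim cv.
Unshelve. all: by end_near.
Qed.
End Gradient.

(** Turns a first order expansion with a remainder C t^2 into an optimality
condition. *)
Lemma ge0_of_quadratic (R : realType) (A C : R) : 0 <= C ->
  (forall t, 0 < t < 1 -> 0 <= t * A + C * t ^+ 2) -> 0 <= A.
Proof.
move=> C0 H; rewrite leNgt; apply/negP => A0.
have D0 : 0 < C - A by lra.
have D2 : 0 < 2 * (C - A) by lra.
pose t := - A / (2 * (C - A)).
have tE : t * (2 * (C - A)) = - A by rewrite /t divfK// gt_eqF.
have t0 : 0 < t by rewrite divr_gt0//; lra.
have t1 : t < 1 by rewrite ltr_pdivrMr//; lra.
have := H t; rewrite t0 t1 => /(_ isT).
have -> : t * A + C * t ^+ 2 = t * (A + C * t) by ring.
have At : A * t < 0 by rewrite nmulr_rlt0.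
rewrite pmulr_rge0// => H0; lra.
Qed.

Lemma proper_convex_segment (R : realType) n (f : 'rV[R]_n -> \bar R)
    u v (a b t : R) :
  proper_lsc_convex f -> f u = a%:E -> f v = b%:E -> 0 < t < 1 ->
  exists2 c, f (t *: u + (1 - t) *: v) = c%:E & c <= t * a + (1 - t) * b.
Proof.
move=> [[fN _] _ cf] fu fv t01; have := cf u v t t01.
rewrite fu fv; have := fN (t *: u + (1 - t) *: v).
by case: (f _) => [c _|//|//]; rewrite lee_fin => ?; exists c.
Qed.

Lemma subdifferential_fin (R : realType) n (f : 'rV[R]_n -> \bar R) u s :
  proper_lsc_convex f -> subdifferential f u s -> f u = (fine (f u))%:E.
Proof.
move=> [[fN [v fv]] _ _] /(_ v) /le_lt_trans/(_ fv).
by have := fN u; case: (f u).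
Qed.

(** * Optimality conditions of the minimax solution *)

Lemma differentiable_partial_x (R : realType) (dx dy : nat)
    (F : 'rV[R]_dx -> 'rV[R]_dy -> R) (x : 'rV[R]_dx) (y : 'rV[R]_dy) :
  continuously_differentiable F -> differentiable (fun x' => F x' y) x.
Proof.
move=> [dF _ _].
apply: (@differentiable_comp _ _ _ _ (fun x' => (x', y)) (fun q => F q.1 q.2)).
  exact: differentiable_pair.
exact: dF.
Qed.

Lemma differentiable_partial_y (R : realType) (dx dy : nat)
    (F : 'rV[R]_dx -> 'rV[R]_dy -> R) (x : 'rV[R]_dx) (y : 'rV[R]_dy) :
  continuously_differentiable F -> differentiable (F x) y.
Proof.
move=> [dF _ _].
apply: (@differentiable_comp _ _ _ _ (fun y' => (x, y')) (fun q => F q.1 q.2)).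
  exact: differentiable_pair.
exact: dF.
Qed.

Section StronglyConvexConcave.
Variables (R : realType) (dx dy : nat) (mux muy L : R).
Variable F : 'rV[R]_dx -> 'rV[R]_dy -> R.
Variables (r : 'rV[R]_dx -> \bar R) (g : 'rV[R]_dy -> \bar R).
Hypotheses (mux_gt0 : 0 < mux) (muy_gt0 : 0 < muy) (L_gt0 : 0 < L).
Hypothesis diffF : continuously_differentiable F.
Hypothesis convF : forall y, strongly_convex mux (fun x => F x y).
Hypothesis concF : forall x, strongly_concave muy (F x).
Hypothesis smoothF : smooth L F.
Hypotheses (r_plc : proper_lsc_convex r) (g_plc : proper_lsc_convex g).

Lemma saddle_convex_x u v y :
  F u y + dot (grad_x F u y) (v - u) + mux / 2 * sqnorm (v - u) <= F v y.
Proof.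
by apply: strongly_convex_gradient (convF y); exact: differentiable_partial_x.
Qed.

Lemma saddle_concave_y x u v :
  F x v <= F x u + dot (grad_y F x u) (v - u) - muy / 2 * sqnorm (v - u).
Proof.
have dF := differentiable_partial_y x u diffF.
have := strongly_convex_gradient v (differentiableN dF) (concF x).
have -> : gradient (- F x) u = - grad_y F x u.
  by apply/rowP => i; rewrite !mxE deriveN//; exact: diff_derivable.
rewrite dotNl => H.
have {}H : - F x u - dot (grad_y F x u) (v - u) + muy / 2 * sqnorm (v - u)
  <= - F x v by exact: H.
lra.
Qed.

Section Optimality.
Variables (xs : 'rV[R]_dx) (ys : 'rV[R]_dy).
Hypothesis sol : minimax_solution F r g xs ys.

Lemma minimax_fin : exists rho gam, r xs = rho%:E /\ g ys = gam%:E.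
Proof.
case: sol => + _ _; rewrite /objective fin_numB fin_numD.
move=> /andP[/andP[rf _] gf].
by exists (fine (r xs)), (fine (g ys)); rewrite !fineK.
Qed.

(** ys maximises F xs - g.  Comparing ys with ys + t (v - ys), concavity is used
at the perturbed point and smoothness brings the gradient back to ys, at the
cost of O(t^2). *)
Lemma subdifferential_grad_y : subdifferential g ys (grad_y F xs ys).
Proof.
have [rho [gam [rE gE]]] := minimax_fin.
have max_ys y c : g y = c%:E -> F xs y - c <= F xs ys - gam.
  move=> gy; have : (objective F r g xs y <= objective F r g xs ys)%E.
    by case: sol => _ -> _; apply: ereal_sup_ubound; exists y.
  by rewrite /objective rE gE gy !lee_fin; lra.
move=> v; rewrite gE.
case Ev : (g v) => [b||]; last 2 first.
- exact: leey.
- by case: g_plc => [[/(_ v)]]; rewrite Ev.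
rewrite lee_fin; set G := grad_y F xs ys; set d := v - ys.
suff : 0 <= b - gam - dot G d by lra.
apply: (@ge0_of_quadratic _ _ ((L ^+ 2 + 1) / 2 * sqnorm d)).
  by rewrite mulr_ge0 ?sqnorm_ge0 ?divr_ge0 ?addr_ge0 ?sqr_ge0.
move=> t t01; have /andP[t0 t1] := t01.
have [c gc cle] := proper_convex_segment g_plc Ev gE t01.
have := max_ys _ _ gc; set yt := t *: v + _ => ytle.
have ytE : yt - ys = t *: d.
  exact: segment_subr.
have := saddle_concave_y xs yt ys.
have -> : ys - yt = - (t *: d) by rewrite -ytE opprB.
rewrite dotNr dotZr => conc.
have sq0 : 0 <= muy / 2 * sqnorm (- (t *: d)).
  by rewrite mulr_ge0 ?sqnorm_ge0// divr_ge0// ltW.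
have := dot_young (G - grad_y F xs yt) (t *: d) ltr01.
rewrite invr1 !mul1r dotZr dotDl dotNl => yng.
have := smoothF xs xs ys yt; rewrite -/G !subrr.
have -> : ys - yt = - (t *: d) by rewrite -ytE opprB.
have -> : sqnorm (0 : 'rV[R]_dx) = 0 by exact: dot0l.
have sqtd := sqnormZ t d.
rewrite sqnormN sqtd !add0r => sm.
rewrite sqtd in yng.
have sx0 := sqnorm_ge0 (grad_x F xs ys - grad_x F xs yt).
set T := dot (grad_y F xs yt) d in yng conc *.
lra.
Qed.

(** Envelope argument.  By the optimality of ys, F xs - g drops by at least
muy/2 |y - ys|^2 away from ys; moving xs by t d changes F (., y) by
t <grad_x F, d> up to an error that smoothness bounds by a term of order
t |d| |y - ys|.  Young's inequality, weighted so that the drop absorbs it,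
leaves O(t^2), uniformly in y.  The minimality of xs for max_objective then
bounds from below the first order variation along d. *)
Lemma subdifferential_opp_grad_x : subdifferential r xs (- grad_x F xs ys).
Proof.
have [rho [gam [rE gE]]] := minimax_fin.
move=> x; rewrite rE.
case Ex : (r x) => [b||]; last 2 first.
- exact: leey.
- by case: r_plc => [[/(_ x)]]; rewrite Ex.
rewrite lee_fin dotNl; set G := grad_x F xs ys; set d := x - xs.
pose C := (muy / 2 + L ^+ 2 / (2 * muy)) * sqnorm d.
suff : 0 <= b - rho + dot G d by lra.
apply: (@ge0_of_quadratic _ _ C).
  by rewrite mulr_ge0 ?sqnorm_ge0// addr_ge0// divr_ge0 ?sqr_ge0//
    ltW ?mulr_gt0.
move=> t t01; have /andP[t0 t1] := t01.
have [c rc cle] := proper_convex_segment r_plc Ex rE t01.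
set xt := t *: x + _ in rc.
have xtE : xt - xs = t *: d by exact: segment_subr.
have sqtd := sqnormZ t d.
have growth y e : g y = e%:E ->
    F xt y - e <= F xs ys - gam + t * dot G d + C * t ^+ 2.
  move=> gy; have := subdifferential_grad_y y; rewrite gE gy lee_fin => sub_g.
  have conc := saddle_concave_y xs ys y.
  have := saddle_convex_x xt xs y.
  have -> : xs - xt = - (t *: d) by rewrite -xtE opprB.
  have sq0 : 0 <= mux / 2 * sqnorm (- (t *: d)).
    by rewrite mulr_ge0 ?sqnorm_ge0// divr_ge0// ltW.
  rewrite dotNr dotZr => conv.
  (* This weight turns |y - ys|^2 into muy/2 |y - ys|^2 after smoothness. *)
  have L2 : 0 < L ^+ 2 by rewrite exprn_gt0.
  have a0 : 0 < muy / L ^+ 2 by rewrite divr_gt0.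
  have := dot_young (grad_x F xt y - G) (t *: d) a0.
  rewrite invf_div sqtd dotZr dotDl dotNl => yng.
  have := smoothF xt xs y ys; rewrite -/G xtE sqtd.
  have := sqnorm_ge0 (grad_y F xt y - grad_y F xs ys) => sy0 sm.
  have sm' : sqnorm (grad_x F xt y - G) <=
      L ^+ 2 * (t ^+ 2 * sqnorm d + sqnorm (y - ys)) by lra.
  have := ler_wpM2l (ltW a0) sm'; rewrite mulrA divfK ?gt_eqF// => bound.
  have CE : C * t ^+ 2 = muy / 2 * (t ^+ 2 * sqnorm d)
      + 2^-1 * (L ^+ 2 / muy * (t ^+ 2 * sqnorm d)).
    by rewrite /C; field; exact: lt0r_neq0.
  rewrite CE.
  set T := dot (grad_x F xt y) d in yng conv *.
  lra.
have : (max_objective F r g xt <=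
    (c + (F xs ys - gam + t * dot G d + C * t ^+ 2))%:E)%E.
  apply: ge_ereal_sup => _ [y _ <-]; rewrite /objective rc.
  case Ey : (g y) => [e||]; last 2 first.
  - by rewrite addeNy leNye.
  - by case: g_plc => [[/(_ y)]]; rewrite Ey.
  by have := growth _ _ Ey; rewrite lee_fin; lra.
case: sol => _ maxE /(_ xt) le_xt /(le_trans le_xt).
rewrite -maxE /objective rE gE lee_fin; lra.
Qed.

End Optimality.

(** * The dual problem *)

Lemma grad_x_hatF x y : grad_x (hatF mux muy F) x y = grad_x F x y - mux *: x.
Proof.
apply/rowP => i; rewrite !mxE.
have dF : is_derive x (delta_mx 0 i) (fun x' => F x' y)
    ('D_(delta_mx 0 i) (fun x' => F x' y) x).
  apply: derivableP; apply: diff_derivable; exact: differentiable_partial_x.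
have dS := derive_sqnorm x (delta_mx 0 i).
have dC := is_derive_cst (muy / 2 * sqnorm y) x (delta_mx 0 i : 'rV[R]_dx).
have [_ H] := is_deriveD (is_deriveB dF (is_deriveZ (mux / 2) dS)) dC.
transitivity ('D_(delta_mx 0 i) (fun x' => F x' y) x
    - mux / 2 *: (2 * dot x (delta_mx 0 i)) + 0); first exact: H.
rewrite addr0 dotC dot_delta -[_ *: _]/(_ * _); by field.
Qed.

Lemma grad_y_hatF x y : grad_y (hatF mux muy F) x y = grad_y F x y + muy *: y.
Proof.
apply/rowP => i; rewrite !mxE.
have dF : is_derive y (delta_mx 0 i) (F x) ('D_(delta_mx 0 i) (F x) y).
  apply: derivableP; apply: diff_derivable; exact: differentiable_partial_y.
have dS := derive_sqnorm y (delta_mx 0 i).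
have dC := is_derive_cst (mux / 2 * sqnorm x) y (delta_mx 0 i : 'rV[R]_dy).
have [_ H] := is_deriveD (is_deriveB dF dC) (is_deriveZ (muy / 2) dS).
transitivity ('D_(delta_mx 0 i) (F x) y - 0
    + muy / 2 *: (2 * dot y (delta_mx 0 i))); first exact: H.
rewrite subr0 dotC dot_delta -[_ *: _]/(_ * _); by field.
Qed.

Lemma hatF_convex_x u v y :
  hatF mux muy F u y + dot (grad_x (hatF mux muy F) u y) (v - u) <=
  hatF mux muy F v y.
Proof.
have := saddle_convex_x u v y.
rewrite grad_x_hatF dotDl dotNl dotZl /hatF (sqnorm_expand u v); lra.
Qed.

Lemma hatF_concave_y x u v :
  hatF mux muy F x v <=
  hatF mux muy F x u + dot (grad_y (hatF mux muy F) x u) (v - u).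
Proof.
have := saddle_concave_y x u v.
rewrite grad_y_hatF dotDl dotZl /hatF (sqnorm_expand u v); lra.
Qed.

(** A certificate that (x, w) is a subgradient of G at (z, y), where
G (z, y) = sup_x (<x, z> - r x - hatF x y) + g y: the first inclusion says that
x attains the supremum. *)
Definition dual_point (x : 'rV[R]_dx) (y : 'rV[R]_dy) (z : 'rV[R]_dx)
    (w : 'rV[R]_dy) : Prop :=
  subdifferential r x (z - grad_x (hatF mux muy F) x y) /\
  subdifferential g y (w + grad_y (hatF mux muy F) x y).

(** The dual objective |z|^2 / (2 mux) + muy/2 |y|^2 + G (z, y), with the
supremum of G replaced by its value at x. *)
Definition dual_value (x : 'rV[R]_dx) (y : 'rV[R]_dy) (z : 'rV[R]_dx) : R :=
  dot x z - fine (r x) - hatF mux muy F x y + fine (g y)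
  + mux^-1 / 2 * sqnorm z + muy / 2 * sqnorm y.

(** G at the second point is at least its value with x1 in place of the
maximiser x2; the subgradient inequality of g and the concavity of hatF x1 then
compare that value with G at the first point.  The quadratic terms are expanded
exactly. *)
Lemma dual_value_convex x1 y1 z1 w1 x2 y2 z2 w2 :
  dual_point x1 y1 z1 w1 -> dual_point x2 y2 z2 w2 ->
  dual_value x1 y1 z1 + dot (x1 + mux^-1 *: z1) (z2 - z1)
    + dot (w1 + muy *: y1) (y2 - y1)
    + mux^-1 / 2 * sqnorm (z2 - z1) + muy / 2 * sqnorm (y2 - y1)
  <= dual_value x2 y2 z2.
Proof.
move=> [r1 g1] [r2 g2].
have := r2 x1; rewrite (subdifferential_fin r_plc r1)
  (subdifferential_fin r_plc r2) lee_fin.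
have := g1 y2; rewrite (subdifferential_fin g_plc g1)
  (subdifferential_fin g_plc g2) lee_fin.
have := hatF_convex_x x2 x1 y2.
have := hatF_concave_y x1 y1 y2.
rewrite /dual_value (sqnorm_expand z1 z2) (sqnorm_expand y1 y2).
rewrite !dotDl !dotZl dotNl (dotC x2 z2).
rewrite (_ : dot x1 (z2 - z1) = dot z2 x1 - dot x1 z1); last first.
  by rewrite dotDr dotNr (dotC x1 z2).
rewrite (_ : dot z2 (x1 - x2) = dot z2 x1 - dot z2 x2); last first.
  by rewrite dotDr dotNr.
lra.
Qed.

Lemma dual_point_solution xs ys : minimax_solution F r g xs ys ->
  dual_point xs ys (- (mux *: xs)) (- (muy *: ys)).
Proof.
move=> sol; split.
  rewrite grad_x_hatF opprB addKr.
  exact: subdifferential_opp_grad_x.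
rewrite grad_y_hatF addrC addrK; exact: subdifferential_grad_y.
Qed.

End StronglyConvexConcave.

(** * One iteration *)

(** The update is a convex combination of u and f followed by a gradient step.
The difference of the two sides is
mu (1 - 2 eta mu) |f - u|^2 + eta |mu (f - u) + d|^2.  It applies to z with
modulus mux^-1 and to y with modulus muy. *)
Lemma block_descent (R : realType) n (mu eta : R) (u us f d : 'rV[R]_n) :
  0 < mu -> 0 < eta -> 2 * (eta * mu) <= 1 ->
  eta^-1 * sqnorm (u + (eta * mu) *: (f - u) - eta *: d - us) <=
  (eta^-1 - mu) * sqnorm (u - us) + mu * sqnorm (f - us)
  - 2 * dot d (u - us) + 2 * eta * sqnorm d.
Proof.
move=> mu0 eta0 etamu.
have s1 : 0 <= mu * (1 - 2 * (eta * mu)) * sqnorm (f - u).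
  by rewrite mulr_ge0 ?sqnorm_ge0// mulr_ge0 ?(ltW mu0)// subr_ge0.
have s2 : 0 <= eta * sqnorm (mu *: (f - u) + d).
  by rewrite mulr_ge0 ?sqnorm_ge0 ?ltW.
rewrite -subr_ge0; apply: le_trans (addr_ge0 s1 s2) _.
rewrite le_eqVlt; apply/orP; left.
apply/eqP; rewrite /sqnorm !dotE (dotC u f) (dotC us f) (dotC us u)
  (dotC d f) (dotC d u) (dotC d us).
by field; exact: lt0r_neq0.
Qed.

(** With d = x + z / mux and a = z - zg, the two vectors of the error criterion
are (a + mux d) / 2 and d - a / mux.  The constants 8 and 1/8 leave a positive
definite quadratic form in a and mux d. *)
Lemma inexact_prox_x (R : realType) n (mux : R) (x z zg : 'rV[R]_n) : 0 < mux ->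
  2 * dot (x + mux^-1 *: z) (z - zg) + mux * sqnorm (x + mux^-1 *: z) <=
  8 / mux * sqnorm (z + (mux / 2) *: (x - mux^-1 *: zg))
  - mux / 8 * sqnorm (x + mux^-1 *: zg).
Proof.
move=> mux0; set d := x + mux^-1 *: z; set a := z - zg.
have -> : z + (mux / 2) *: (x - mux^-1 *: zg) = 2^-1 *: a + (mux / 2) *: d.
  apply/rowP => i; rewrite !mxE; field; exact: lt0r_neq0.
have -> : x + mux^-1 *: zg = d - mux^-1 *: a.
  apply/rowP => i; rewrite !mxE; field; exact: lt0r_neq0.
clearbody a d.
(* Completing the square in a; the remaining coefficient of |d|^2 is
   7/8 - 27/40 = 1/5. *)
have s1 : 0 <= 15 / 8 * mux^-1 * sqnorm (a + (3 / 5 * mux) *: d).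
  by rewrite mulr_ge0 ?sqnorm_ge0// mulr_ge0 ?divr_ge0 ?invr_ge0 ?ltW.
have s2 : 0 <= 5^-1 * mux * sqnorm d.
  by rewrite mulr_ge0 ?sqnorm_ge0 ?mulr_ge0 ?invr_ge0 ?ltW.
rewrite -subr_ge0; apply: le_trans (addr_ge0 s1 s2) _.
rewrite le_eqVlt; apply/orP; left.
by apply/eqP; rewrite /sqnorm !dotE (dotC a d); field; exact: lt0r_neq0.
Qed.

(** The analogue for y, where the criterion is exactly the inequality needed. *)
Lemma inexact_prox_y (R : realType) n (thetay : R) (d e : 'rV[R]_n) :
  0 < thetay ->
  2 * dot d e + thetay * sqnorm d =
  thetay * sqnorm (d + thetay^-1 *: e) - thetay^-1 * sqnorm e.
Proof.
by move=> th0; rewrite /sqnorm !dotE (dotC e d); field; exact: lt0r_neq0.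
Qed.

Section Convergence.
Variables (R : realType) (dx dy : nat) (mux muy L : R).
Variable F : 'rV[R]_dx -> 'rV[R]_dy -> R.
Variables (r : 'rV[R]_dx -> \bar R) (g : 'rV[R]_dy -> \bar R).
Hypotheses (mux_gt0 : 0 < mux) (muy_gt0 : 0 < muy) (L_gt0 : 0 < L).
Hypothesis diffF : continuously_differentiable F.
Hypothesis convF : forall y, strongly_convex mux (fun x => F x y).
Hypothesis concF : forall x, strongly_concave muy (F x).
Hypothesis smoothF : smooth L F.
Hypotheses (r_plc : proper_lsc_convex r) (g_plc : proper_lsc_convex g).
Variables (xs : 'rV[R]_dx) (ys : 'rV[R]_dy).
Hypothesis sol : minimax_solution F r g xs ys.
Variables (alpha etay thetay : R).
Hypotheses (alpha_gt0 : 0 < alpha) (alpha_le1 : alpha <= 1).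
Hypotheses (thetay_gt0 : 0 < thetay) (etay_gt0 : 0 < etay).
Hypothesis etay_muy : 2 * (etay * muy) <= 1.
Hypothesis etay_thetay : 2 * alpha * etay <= thetay.

Let step := app_step mux muy F r g alpha (mux / 2) etay thetay.
Let zs : 'rV[R]_dx := - (mux *: xs).
Let dual := dual_point mux muy F r g.
Let P := dual_value mux muy F r g.
Let gap x (s : app_state R dx dy) := P x (st_yf s) (st_zf s) - P xs ys zs.

Definition dist_energy z y : R :=
  2 / mux * sqnorm (z - zs) + etay^-1 * sqnorm (y - ys).

(** The energy is multiplied by alpha, so that the acceleration identity
alpha u = q - (1 - alpha) p, with q the extrapolated and p the previous point,
can be used without divisions. *)
Definition lyapunov x (s : app_state R dx dy) : R :=
  alpha * dist_energy (st_z s) (st_y s) + 2 * gap x s.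

Lemma dist_energy_ge0 z y : 0 <= dist_energy z y.
Proof.
by rewrite addr_ge0// mulr_ge0 ?sqnorm_ge0// ?divr_ge0 ?invr_ge0// ltW.
Qed.

Lemma dual_sol : dual xs ys zs (- (muy *: ys)).
Proof. exact: (dual_point_solution mux_gt0 muy_gt0 L_gt0). Qed.

(** The subgradient of the dual objective vanishes at (zs, ys). *)
Lemma gap_ge0 x w s : dual x (st_yf s) (st_zf s) w -> 0 <= gap x s.
Proof.
move=> /(dual_value_convex diffF convF concF r_plc g_plc dual_sol).
rewrite /zs scalerN scalerA mulVf ?gt_eqF// scale1r subrr addNr !dot0l.
have a1 : 0 <= mux^-1 / 2 * sqnorm (st_zf s - - (mux *: xs)).
  by rewrite mulr_ge0 ?sqnorm_ge0// divr_ge0 ?invr_ge0 ?ltW.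
have a2 : 0 <= muy / 2 * sqnorm (st_yf s - ys).
  by rewrite mulr_ge0 ?sqnorm_ge0// divr_ge0 ?ltW.
by rewrite /gap /zs /P; lra.
Qed.

(** What an iteration contributes to both the generic and the first step, with
dz and dv the components of the subgradient of the dual objective at the new
point: the error criterion, strong convexity towards the solution, and the
descent of the two blocks. *)
Lemma app_step_estimates s s' : step s s' ->
  let zg := alpha *: st_z s + (1 - alpha) *: st_zf s in
  let yg := alpha *: st_y s + (1 - alpha) *: st_yf s in
  exists x w, let dz := x + mux^-1 *: st_zf s' in
              let dv := w + muy *: st_yf s' in
  [/\ dual x (st_yf s') (st_zf s') w,
      2 * dot dz (st_zf s' - zg) + 2 * dot dv (st_yf s' - yg)
        + mux * sqnorm dz + thetay * sqnorm dv <= 0,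
      2 * gap x s' + mux^-1 * sqnorm (st_zf s' - zs)
        + muy * sqnorm (st_yf s' - ys)
        <= 2 * dot dz (st_zf s' - zs) + 2 * dot dv (st_yf s' - ys),
      2 / mux * sqnorm (st_z s' - zs) <= mux^-1 * sqnorm (st_z s - zs)
        + mux^-1 * sqnorm (st_zf s' - zs) - 2 * dot dz (st_z s - zs)
        + mux * sqnorm dz
    & etay^-1 * sqnorm (st_y s' - ys) <= (etay^-1 - muy) * sqnorm (st_y s - ys)
        + muy * sqnorm (st_yf s' - ys) - 2 * dot dv (st_y s - ys)
        + 2 * etay * sqnorm dv].
Proof.
move=> [xf [yf [zf [wf [rx gy inexact ->]]]]] /=.
exists xf, wf; set dz := xf + _; set dv := wf + _.
set zg := alpha *: st_z s + _ in inexact *.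
set yg := alpha *: st_y s + _ in inexact *.
have dualf : dual xf yf zf wf by split.
split => //.
- have := inexact_prox_x xf zf zg mux_gt0.
  have := inexact_prox_y dv (yf - yg) thetay_gt0.
  rewrite -/dz; move: inexact; rewrite -/dv; lra.
- have := dual_value_convex diffF convF concF r_plc g_plc dualf dual_sol.
  rewrite -/dz -/dv /gap /= -/P (sqnormBC zs) (sqnormBC ys)
    -(opprB zf zs) -(opprB yf ys).
  rewrite !dotNr; lra.
- have e0 : 0 < mux / 2 by rewrite divr_gt0.
  have m0 : 0 < mux^-1 by rewrite invr_gt0.
  have := @block_descent _ _ mux^-1 (mux / 2) (st_z s) zs zf dz m0 e0.
  have -> : 2 * (mux / 2 / mux) = 1 by field; exact: lt0r_neq0.
  rewrite lexx invf_div => /(_ isT).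
  have -> : 2 / mux - mux^-1 = mux^-1 by ring.
  have -> : 2 * (mux / 2) = mux by field.
  by [].
- exact: block_descent.
Qed.

(** Scale the descent of the blocks and the inequality towards the solution by
alpha, the inequality towards the previous point by 1 - alpha, and add the error
criterion.  The relation defining the extrapolated point cancels all inner
products, strong convexity cancels the distances of the new point, and the
criterion absorbs the squared subgradient since 2 alpha etay <= thetay. *)
Lemma lyapunov_contracts rho xp wp s s' :
  rho <= 2^-1 -> rho <= alpha -> rho <= etay * muy ->
  dual xp (st_yf s) (st_zf s) wp -> step s s' ->
  exists x w, dual x (st_yf s') (st_zf s') w /\
    lyapunov x s' <= (1 - rho) * lyapunov xp s.
Proof.
move=> rho2 rhoa rhoe dualp /app_step_estimates[x [w []]].
set zg := alpha *: st_z s + _; set yg := alpha *: st_y s + _.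
set dz := x + _; set dv := w + _ => dualx inexact gap_le desz desy.
exists x, w; split=> //.
have gapp := gap_ge0 dualp.
have conv := dual_value_convex diffF convF concF r_plc g_plc dualx dualp.
have a1 : 0 <= mux^-1 / 2 * sqnorm (st_zf s - st_zf s').
  by rewrite mulr_ge0 ?sqnorm_ge0// divr_ge0 ?invr_ge0 ?ltW.
have a2 : 0 <= muy / 2 * sqnorm (st_yf s - st_yf s').
  by rewrite mulr_ge0 ?sqnorm_ge0// divr_ge0 ?ltW.
have {conv a1 a2} conv :
    gap x s' + dot dz (st_zf s - st_zf s') + dot dv (st_yf s - st_yf s')
    <= gap xp s.
  by move: conv; rewrite /gap /P -/dz -/dv; lra.
have mixz : alpha * dot dz (st_z s - zs) = - dot dz (st_zf s' - zg)
    - (1 - alpha) * dot dz (st_zf s - st_zf s')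
    + alpha * dot dz (st_zf s' - zs).
  by rewrite /zg; rewrite !dotDr !dotNr dotDr !dotZr; ring.
have mixy : alpha * dot dv (st_y s - ys) = - dot dv (st_yf s' - yg)
    - (1 - alpha) * dot dv (st_yf s - st_yf s')
    + alpha * dot dv (st_yf s' - ys).
  by rewrite /yg; rewrite !dotDr !dotNr dotDr !dotZr; ring.
have d2 := ler_wpM2r (sqnorm_ge0 dv) etay_thetay.
have d1 : alpha * (mux * sqnorm dz) <= mux * sqnorm dz.
  by rewrite ler_piMl// mulr_ge0 ?sqnorm_ge0 ?ltW.
have a0 := ltW alpha_gt0.
have a1 : 0 <= 1 - alpha by rewrite subr_ge0.
have {desz} desz := ler_wpM2l a0 desz.
have {desy} desy := ler_wpM2l a0 desy.
have {gap_le} gap_le := ler_wpM2l a0 gap_le.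
have {conv} conv := ler_wpM2l a1 conv.
have main : lyapunov x s' <= alpha * (mux^-1 * sqnorm (st_z s - zs)
    + (etay^-1 - muy) * sqnorm (st_y s - ys)) + 2 * ((1 - alpha) * gap xp s).
  rewrite /lyapunov /dist_energy; lra.
apply: le_trans main _.
have -> : (1 - rho) * lyapunov xp s =
   alpha * ((1 - rho) * dist_energy (st_z s) (st_y s))
   + 2 * ((1 - rho) * gap xp s) by rewrite /lyapunov; ring.
apply: lerD.
  rewrite ler_pM2l// /dist_energy mulrDr !mulrA.
  apply: lerD; apply: ler_wpM2r; rewrite ?sqnorm_ge0//.
    by rewrite ler_peMl ?invr_ge0 ?(ltW mux_gt0)//; lra.
  suff : rho / etay <= muy by lra.
  by rewrite ler_pdivrMr// mulrC.
by rewrite ler_pM2l// ler_wpM2r//; lra.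
Qed.

(** At the first iteration the extrapolated point is the initial point itself,
so the error criterion and strong convexity towards the solution alone bound the
gap, the subgradient and the new point. *)
Lemma lyapunov_first_step (z0 : 'rV[R]_dx) (y0 : 'rV[R]_dy) s' :
  let B0 := 2 / mux * sqnorm (z0 - zs) + 2 / thetay * sqnorm (y0 - ys) in
  step {| st_z := z0; st_y := y0; st_zf := z0; st_yf := y0 |} s' ->
  exists x w, dual x (st_yf s') (st_zf s') w /\
    lyapunov x s' <= dist_energy z0 y0 + 4 * B0.
Proof.
move=> B0 /app_step_estimates[x [w []]] /=.
set dz := x + _; set dv := w + _.
have av n (u : 'rV[R]_n) : alpha *: u + (1 - alpha) *: u = u.
  by rewrite -scalerDl addrC subrK scale1r.
rewrite !av => dualx inexact gap_le desz desy.
exists x, w; split=> //.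
have gap0 := gap_ge0 dualx.
have h0 : 0 < mux / 2 by rewrite divr_gt0.
have t0 : 0 < thetay / 2 by rewrite divr_gt0.
have yz := dot_young dz (z0 - zs) h0.
have yy := dot_young dv (y0 - ys) t0.
have yz' := dot_young (- dz) (z0 - zs) h0.
have yy' := dot_young (- dv) (y0 - ys) t0.
move: yz yy yz' yy'; rewrite !invf_div !sqnormN !dotNl => yz yy yz' yy'.
have total : 2 * gap x s' + mux / 2 * sqnorm dz + thetay / 2 * sqnorm dv
   + mux^-1 * sqnorm (st_zf s' - zs) + muy * sqnorm (st_yf s' - ys) <= B0.
  have sz : dot dz (st_zf s' - zs) = dot dz (st_zf s' - z0) + dot dz (z0 - zs).
    by rewrite -dotDr addrA subrK.
  have sy : dot dv (st_yf s' - ys) = dot dv (st_yf s' - y0) + dot dv (y0 - ys).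
    by rewrite -dotDr addrA subrK.
  rewrite /B0; lra.
have a0 := ltW alpha_gt0.
have m0 := ltW mux_gt0; have im0 : 0 <= mux^-1 by rewrite invr_ge0.
have p1 := mulr_ge0 m0 (sqnorm_ge0 dz).
have p2 := mulr_ge0 (ltW thetay_gt0) (sqnorm_ge0 dv).
have p3 := mulr_ge0 im0 (sqnorm_ge0 (st_zf s' - zs)).
have p4 := mulr_ge0 (ltW muy_gt0) (sqnorm_ge0 (st_yf s' - ys)).
have p5 := mulr_ge0 im0 (sqnorm_ge0 (z0 - zs)).
have p6 := mulr_ge0 (ltW muy_gt0) (sqnorm_ge0 (y0 - ys)).
have p8 : 0 <= 2 / thetay * sqnorm (y0 - ys).
  by rewrite mulr_ge0 ?sqnorm_ge0 ?divr_ge0 ?ltW.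
have p7 : 0 <= (etay^-1 - muy) * sqnorm (y0 - ys).
  have em0 : 0 < etay * muy by exact: mulr_gt0.
  have em1 : etay * muy <= 1.
    by apply: le_trans etay_muy; rewrite ler_peMl ?ler1n ?ltW.
  rewrite mulr_ge0 ?sqnorm_ge0// subr_ge0 -(ler_pM2l etay_gt0) divff ?gt_eqF//.
have d2 := ler_wpM2r (sqnorm_ge0 dv) etay_thetay.
have ez : alpha * (2 / mux * sqnorm (st_z s' - zs)) <=
    2 / mux * sqnorm (st_z s' - zs).
  by rewrite ler_piMl// mulr_ge0 ?sqnorm_ge0 ?divr_ge0.
pose Y := (etay^-1 - muy) * sqnorm (y0 - ys) + muy * sqnorm (st_yf s' - ys)
   + thetay / 2 * sqnorm dv + 2 / thetay * sqnorm (y0 - ys).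
have Y0 : 0 <= Y by rewrite /Y; lra.
have ey : alpha * (etay^-1 * sqnorm (st_y s' - ys)) <= Y + thetay * sqnorm dv.
  have : etay^-1 * sqnorm (st_y s' - ys) <= Y + 2 * etay * sqnorm dv.
    by rewrite /Y; lra.
  move=> /(ler_wpM2l a0) /le_trans; apply.
  have : alpha * Y <= Y by rewrite ler_piMl.
  lra.
rewrite /lyapunov /dist_energy; move: ey; rewrite /Y /B0 in total *; lra.
Qed.

(** * Convergence *)

Lemma lyapunov_run rho z0 y0 (s : nat -> app_state R dx dy) K :
  let B := dist_energy z0 y0 +
    4 * (2 / mux * sqnorm (z0 - zs) + 2 / thetay * sqnorm (y0 - ys)) in
  rho <= 2^-1 -> rho <= alpha -> rho <= etay * muy ->
  s 0%N = {| st_z := z0; st_y := y0; st_zf := z0; st_yf := y0 |} ->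
  (forall k, (k <= K)%N -> step (s k) (s k.+1)) ->
  alpha * dist_energy (st_z (s K.+1)) (st_y (s K.+1)) <= (1 - rho) ^+ K * B.
Proof.
move=> B rho2 rhoa rhoe s0 sS.
have run k : (k <= K)%N -> exists x w,
    dual x (st_yf (s k.+1)) (st_zf (s k.+1)) w /\
    lyapunov x (s k.+1) <= (1 - rho) ^+ k * B.
  elim: k => [|k IH] kK.
    rewrite expr0 mul1r; apply: lyapunov_first_step; rewrite -s0; exact: sS.
  have [x [w [dualx le_x]]] := IH (ltnW kK).
  have [x' [w' [dualx' le_x']]] :=
    lyapunov_contracts rho2 rhoa rhoe dualx (sS _ kK).
  exists x', w'; split=> //; apply: le_trans le_x' _.
  by rewrite exprS -mulrA ler_wpM2l//; lra.
have [x [w [dualx]]] := run K (leqnn K).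
have := gap_ge0 dualx; rewrite /lyapunov; lra.
Qed.

Lemma accuracy_le_dist_energy z y :
  sqnorm (- (mux^-1 *: z) - xs) + sqnorm (y - ys) <=
  ((2 * mux)^-1 + etay) * dist_energy z y.
Proof.
have -> : - (mux^-1 *: z) - xs = - (mux^-1 *: (z - zs)).
  by rewrite /zs opprK scalerDr scalerA mulVf ?gt_eqF// scale1r opprD.
rewrite sqnormN sqnormZ.
have m0 : 0 <= 2 / mux by rewrite divr_ge0 ?ltW.
have m1 : 0 <= (2 * mux)^-1 by rewrite invr_ge0 ltW ?mulr_gt0.
have e1 : 0 <= etay^-1 by rewrite invr_ge0 ltW.
have s1 := mulr_ge0 (mulr_ge0 (ltW etay_gt0) m0) (sqnorm_ge0 (z - zs)).
have s2 := mulr_ge0 (mulr_ge0 m1 e1) (sqnorm_ge0 (y - ys)).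
rewrite -subr_ge0; apply: le_trans (addr_ge0 s1 s2) _.
rewrite le_eqVlt; apply/orP; left.
apply/eqP; rewrite /dist_energy; field.
by rewrite !gt_eqF.
Qed.

End Convergence.

Lemma rate_bounds (R : realType) (alpha thetay muy : R) :
  let Q := Num.max alpha^-1 (alpha / (thetay * muy)) in
  let etay := Num.min (2 * muy)^-1 (thetay / (2 * alpha)) in
  0 < alpha <= 1 -> 0 < thetay -> 0 < muy ->
  [/\ 1 <= Q, (2 * Q)^-1 <= 2^-1, (2 * Q)^-1 <= alpha
    & (2 * Q)^-1 <= etay * muy].
Proof.
move=> Q etay /andP[a0 a1] th0 muy0.
have Qa : alpha^-1 <= Q by rewrite le_max lexx.
have Q1 : 1 <= Q by apply: le_trans Qa; rewrite invf_ge1.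
have Q0 : 0 < Q by lra.
set rho := (2 * Q)^-1.
have rho0 : 0 < rho by rewrite invr_gt0 mulr_gt0.
have rhoQ : rho * Q = 2^-1 by rewrite /rho; field; exact: lt0r_neq0.
have rho2 : rho <= 2^-1 by rewrite -rhoQ ler_peMr// ltW.
split=> //.
  have : alpha * rho * alpha^-1 <= alpha * rho * Q.
    by rewrite ler_pM2l ?mulr_gt0.
  rewrite (mulrAC alpha) divff ?gt_eqF// mul1r -mulrA rhoQ; lra.
rewrite /etay minEle; case: ifP => _.
  by rewrite invfM mulrVK ?unitfE ?gt_eqF.
have Qb : alpha / (thetay * muy) <= Q by rewrite le_max lexx orbT.
rewrite ler_pdivrMr ?mulr_gt0// in Qb.
rewrite mulrAC ler_pdivlMr ?mulr_gt0//.
have := ler_wpM2l (ltW rho0) Qb; rewrite mulrA rhoQ; lra.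
Qed.

Lemma geometric_decay (R : realType) (Q C eps : R) (K : nat) :
  1 <= Q -> 0 < C -> 0 < eps -> 2 * Q * ln (C / eps) <= K%:R ->
  (1 - (2 * Q)^-1) ^+ K <= eps / C.
Proof.
move=> Q1 C0 eps0 Kge; set rho := (2 * Q)^-1.
have Q0 : 0 < Q by lra.
have rho0 : 0 < rho by rewrite invr_gt0 mulr_gt0.
have rhoQ : rho * Q = 2^-1 by rewrite /rho; field; exact: lt0r_neq0.
have rho1 : rho <= 1.
  have : rho <= rho * Q by rewrite ler_peMr// ltW.
  lra.
have -> : eps / C = expR (- ln (C / eps)).
  by rewrite expRN lnK ?invf_div// posrE divr_gt0.
apply: le_trans (_ : expR (- rho) ^+ K <= _).
  by apply: lerXn2r; rewrite ?nnegrE ?expR_ge0 ?expR_ge1Dx//; lra.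
rewrite -expRM_natl ler_expR mulrN lerN2.
have := ler_wpM2r (ltW rho0) Kge.
have -> : 2 * Q * ln (C / eps) * rho = 2 * (rho * Q) * ln (C / eps) by ring.
by rewrite rhoQ mulfV// mul1r.
Qed.

Theorem theorem1 (R : realType) :
  exists c : R, 0 < c /\
  forall (dx dy : nat) (mux muy L : R)
    (F : 'rV[R]_dx -> 'rV[R]_dy -> R)
    (r : 'rV[R]_dx -> \bar R) (g : 'rV[R]_dy -> \bar R),
    0 < mux -> 0 < muy -> 0 < L ->
    continuously_differentiable F ->
    (forall y : 'rV[R]_dy, strongly_convex mux (fun x => F x y)) ->
    (forall x : 'rV[R]_dx, strongly_concave muy (F x)) ->
    smooth L F ->
    proper_lsc_convex r ->
    proper_lsc_convex g ->
  forall (xs : 'rV[R]_dx) (ys : 'rV[R]_dy),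
    minimax_solution F r g xs ys ->
  forall alpha thetay : R,
    0 < alpha <= 1 -> 0 < thetay ->
  forall (z0 : 'rV[R]_dx) (y0 : 'rV[R]_dy),
  exists C : R, 2 <= C /\
  forall (eps : R) (K : nat) (zK : 'rV[R]_dx) (yK : 'rV[R]_dy),
    0 < eps < 1 ->
    c * Num.max alpha^-1 (alpha / (thetay * muy)) * ln (C / eps) <= K%:R ->
    app_output mux muy F r g alpha (mux / 2)
      (Num.min (2 * muy)^-1 (thetay / (2 * alpha))) thetay z0 y0 K zK yK ->
    accurate_solution eps xs ys (- (mux^-1 *: zK)) yK.
Proof.
exists 2; split=> // dx dy mux muy L F r g.
move=> mux0 muy0 L0 dF convF concF smF rP gP.
move=> xs ys sol alpha thetay a01 th0 z0 y0.
have /andP[a0 a1] := a01.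
have [Q1 rho2 rhoa rhoe] := rate_bounds a01 th0 muy0.
set etay := Num.min _ _ in rhoe *.
set Q := Num.max _ _ in Q1 rho2 rhoa rhoe *.
have etay0 : 0 < etay by rewrite lt_min invr_gt0 divr_gt0 ?mulr_gt0.
have etay_muy : 2 * (etay * muy) <= 1.
  have : etay <= (2 * muy)^-1 by rewrite ge_min lexx.
  by rewrite -[_^-1]mul1r ler_pdivlMr ?mulr_gt0//; lra.
have etay_thetay : 2 * alpha * etay <= thetay.
  have : etay <= thetay / (2 * alpha) by rewrite ge_min lexx orbT.
  by rewrite ler_pdivlMr ?mulr_gt0//; lra.
pose zs := - (mux *: xs).
pose B := dist_energy mux xs ys etay z0 y0 +
  4 * (2 / mux * sqnorm (z0 - zs) + 2 / thetay * sqnorm (y0 - ys)).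
pose A := ((2 * mux)^-1 + etay) / alpha.
exists (Num.max 2 (2 * A * B)); split; first by rewrite le_max lexx.
set C := Num.max _ _ => eps K zK yK /andP[eps0 eps1] Kge [s [s0 sS -> ->]].
have C2 : 2 <= C by rewrite le_max lexx.
have Cp : 0 < C by lra.
have Q0 : 0 < Q by lra.
have decay := geometric_decay Q1 Cp eps0 Kge.
(* The bound holds only from the first iterate on; since C / eps > 1 the
   iteration count cannot be 0. *)
have Ceps : 1 < C / eps by rewrite ltr_pdivlMr// mul1r; lra.
have K0 : (0 < K)%N.
  by rewrite -(ltr0n R); apply: lt_le_trans Kge; rewrite !mulr_gt0// ln_gt0.
case: K K0 Kge sS decay => // K _ Kge sS.
have := lyapunov_run mux0 muy0 L0 dF convF concF smF rP gP sol a0 a1 th0 etay0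
  etay_muy etay_thetay rho2 rhoa rhoe s0 sS.
rewrite -/zs -/B => run.
set rho := (2 * Q)^-1 in rho2 rhoa rhoe run * => decay.
rewrite /accurate_solution.
apply: le_trans (accuracy_le_dist_energy mux0 xs ys etay0 _ _) _.
set E := dist_energy _ _ _ _ _ _ in run *.
have A0 : 0 < A by rewrite divr_gt0// addr_gt0// invr_gt0 mulr_gt0.
have -> : ((2 * mux)^-1 + etay) * E = A * (alpha * E).
  by rewrite /A mulrA divfK ?gt_eqF.
apply: le_trans (_ : A * ((1 - rho) ^+ K * B) <= _); first by rewrite ler_pM2l.
have B0 : 0 <= B.
  rewrite addr_ge0 ?dist_energy_ge0// mulr_ge0//.
  rewrite addr_ge0// mulr_ge0 ?sqnorm_ge0//.
    by rewrite divr_ge0 ?ltW.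
  by rewrite divr_ge0 ?ltW.
(* The exponent lost to the first iteration costs a factor 2, which C pays. *)
have shift : (1 - rho) ^+ K <= 2 * (1 - rho) ^+ K.+1.
  rewrite exprS mulrA ler_peMl ?exprn_ge0//; lra.
have ABC : 2 * A * B <= C by rewrite le_max lexx orbT.
have AB0 : 0 <= A * B by rewrite mulr_ge0// ltW.
have -> : A * ((1 - rho) ^+ K * B) = A * B * (1 - rho) ^+ K by ring.
apply: le_trans (_ : A * B * (2 * (eps / C)) <= _).
  by rewrite ler_wpM2l//; lra.
have -> : A * B * (2 * (eps / C)) = (2 * A * B) * eps / C by ring.
by rewrite ler_pdivrMr// mulrC ler_pM2l.
Qed.
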